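(* Let $p\in\mathcal D$, let $n_{max}\in\mathbb N_0$, and let $\mu\in\mathbb N_0^{N_p}$ be a multiindex with $|\mu|=n\le n_{max}$. Let $u^n_{h,\mu}\in X_h$ be the finite element $\mu$-th sensitivity at $p$ (for $n=0$ the finite element state) and let $u^{n,\ell}_{h,\mu}\in X_h$ be the corresponding reduced order solution, as defined in the context. Then $$ \|u^n_{h,\mu}-u^{n,\ell}_{h,\mu}\|_{X_h}\;\le\;\Delta^{\ell}_{u^n_\mu}(p):=\frac{1}{\alpha(p)}\left(\|r_{u^n_\mu}(\cdot\,;p)\|_{(X_h)'}+\sum_{\substack{\kappa\le\mu\\ 1\le|\kappa|\le n}}\binom{\mu}{\kappa}\,\gamma_\kappa\,\Delta^{\ell}_{u^{n-|\kappa|}_{\mu-\kappa}}(p)\right), $$ where the bounds $\Delta^\ell$ are defined recursively by this formula in the order of the sensitivity (for $n=0$ the sum is empty), $r_{u^n_\mu}$ is the residual, $\alpha(p)$ is the coercivity constant of $a(\cdot,\cdot;p)$, and $\gamma_\kappa$ is the continuity constant of the $\kappa$-th parameter derivative $\frac{\partial^\kappa a}{\partial p^\kappa}(\cdot,\cdot;p)$ of the bilinear form.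
   Context: Setting. $\mathcal D\subset\mathbb R^{N_p}$ is the (open) parameter set, $\bar\Omega\subset\mathbb R^2$ is a fixed bounded regular reference domain, and $X=X(\bar\Omega)$ is a real separable Hilbert space with $H^1_0(\bar\Omega)\subset X\subset H^1(\bar\Omega)$, norm $\|\cdot\|_X$. For each $p\in\mathcal D$, $a(\cdot,\cdot;p)$ is a bilinear form on $X$ and $f(\cdot;p)$ is a continuous linear form on $X$. The form $a$ is uniformly continuous and uniformly coercive in $p$, with coercivity constant $$\alpha(p)=\inf_{w\in X,\,w\ne0}\frac{a(w,w;p)}{\|w\|_X^2}>0 .$$ Both forms are affinely parametrized: $a(u,v;p)=\sum_{q=1}^{Q}\sum_{i,j=1}^2\hat\Phi_q^{i,j}(p)\,a_q^{i,j}(u,v)$ and $f(v;p)=\sum_{q=1}^{Q}\hat\Phi^f_q(p)f_q(v)$, with parameter-independent continuous bilinear forms $a_q^{i,j}$ and continuous linear forms $f_q$ on $X$, and real-valued coefficient functions $\hat\Phi_q^{i,j},\hat\Phi_q^f$ on $\mathcal D$ that are $n_{max}$ times differentiable. For a multiindex $\kappa\in\mathbb N_0^{N_p}$, $\frac{\partial^\kappa a}{\partial p^\kappa}$ and $\frac{\partial^\kappa f}{\partial p^\kappa}$ are the forms obtained by differentiating the coefficient functions. Write $\binom{\mu}{\kappa}=\prod_{i=1}^{N_p}\binom{\mu_i}{\kappa_i}$, which vanishes unless $\kappa\le\mu$ componentwise; all sums over $\kappa$ run over $\kappa\le\mu$. Finite element sensitivities. $X_h\subset X$ is a finite-dimensional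 subspace equipped with the norm $\|\cdot\|_{X_h}=\|\cdot\|_X$. The functions $u^m_{h,\nu}\in X_h$, for multiindices $\nu\in\mathbb N_0^{N_p}$ with $|\nu|=m\le n_{max}$, are defined recursively by $$a(u^m_{h,\nu},v;p)=\frac{\partial^\nu f}{\partial p^\nu}(v;p)-\sum_{1\le|\kappa|\le m}\binom{\nu}{\kappa}\frac{\partial^\kappa a}{\partial p^\kappa}(u^{m-|\kappa|}_{h,\nu-\kappa},v;p)\quad\forall v\in X_h;$$ for $m=0$ this is the discrete state equation $a(u_h,v;p)=f(v;p)$ for all $v\in X_h$. Reduced solutions. Let $X^\ell\subset X_h$ be the $\ell$-dimensional subspace spanned by the reduced (POD) basis. The reduced solutions $u^{m,\ell}_{h,\nu}\in X^\ell\subset X_h$, $|\nu|=m\le n_{max}$, are the Galerkin solutions in $X^\ell$, i.e. defined recursively by $$a(u^{m,\ell}_{h,\nu},v;p)=\frac{\partial^\nu f}{\partial p^\nu}(v;p)-\sum_{1\le|\kappa|\le m}\binom{\nu}{\kappa}\frac{\partial^\kappa a}{\partial p^\kappa}(u^{m-|\kappa|,\ell}_{h,\nu-\kappa},v;p)\quad\forall v\in X^\ell .$$ Residual. For $|\mu|=n$ and $v\in X_h$, $$r_{u^n_\mu}(v;p)=\frac{\partial^\mu f}{\partial p^\mu}(v;p)-\sum_{1\le|\kappa|\le n}\binom{\mu}{\kappa}\frac{\partial^\kappa a}{\partial p^\kappa}(u^{n-|\kappa|,\ell}_{h,\mu-\kappa},v;p)-a(u^{n,\ell}_{h,\mu},v;p),$$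 and $\|r\|_{(X_h)'}=\sup_{v\in X_h,\,v\neq0}|r(v)|/\|v\|_{X_h}$ is the dual norm. Continuity constants. $$\gamma_\kappa=\sup_{v\in X,\,v\ne0}\ \sup_{w\in X,\,w\ne0}\frac{\left|\frac{\partial^\kappa a}{\partial p^\kappa}(w,v;p)\right|}{\|w\|_X\|v\|_X}.$$ *)

(* Defs.v *)
From HB Require Import structures.
From mathcomp Require Import all_boot all_order all_algebra.
From mathcomp Require Import all_classical all_reals all_analysis.
Set Implicit Arguments.
Unset Strict Implicit.
Unset Printing Implicit Defensive.
Import Order.TTheory GRing.Theory Num.Theory.
Import numFieldNormedType.Exports.
Local Open Scope classical_set_scope.
Local Open Scope ring_scope.

Section Multiindices.
Variable N : nat.

Definition midx := {ffun 'I_N -> nat}.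

Implicit Types mu kappa : midx.

Definition midx_order mu : nat := (\sum_(i < N) mu i)%N.

Definition midx_le kappa mu : Prop := forall i, (kappa i <= mu i)%N.

(* Truncated componentwise; only used for [kappa <= mu]. *)
Definition midx_sub mu kappa : midx := [ffun i => (mu i - kappa i)%N].

Definition midx_binom mu kappa : nat := (\prod_(i < N) 'C(mu i, kappa i))%N.

Definition midx_below mu (n : nat) : set midx :=
  [set kappa | midx_le kappa mu /\ (1 <= midx_order kappa <= n)%N].

Lemma midx_order_sub mu kappa : midx_le kappa mu ->
  midx_order (midx_sub mu kappa) = (midx_order mu - midx_order kappa)%N.
Proof.
move=> le_km; rewrite /midx_order -sumnB; last by move=> i _; exact: le_km.
by apply: eq_bigr => i _; rewrite ffunE.
Qed.

End Multiindices.

Section ParameterDerivatives.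
Variables (R : realType) (N : nat).
Implicit Types (f : 'rV[R]_N -> R) (D : set 'rV[R]_N).

Definition partial_derive (i : 'I_N) f : 'rV[R]_N -> R :=
  fun p => 'D_(delta_mx 0 i) f p.

(* d_0^(kappa 0) ... d_(N-1)^(kappa (N-1)) f *)
Definition midx_derive (kappa : midx N) f : 'rV[R]_N -> R :=
  foldr (fun i g => iter (kappa i) (partial_derive i) g) f (enum 'I_N).

(* f is (n+1) times differentiable on the open set D iff it is Frechet
   differentiable on D and its partial derivatives (the coordinates of Df) are
   n times differentiable on D. *)
Fixpoint n_differentiable (n : nat) D f : Prop :=
  if n is n'.+1 then
    (forall p, D p -> differentiable f p) /\
    (forall i, n_differentiable n' D (partial_derive i f))
  else True.

End ParameterDerivatives.

Section Spaces.
Variables (R : realType) (X : normedModType R).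
Implicit Types (V : set X) (b : X -> X -> R) (r : X -> R).

Definition separable : Prop := exists2 S : set X, countable S & dense S.

Definition norm_of_dot (dot : {dot X for (@idfun R)}) : Prop :=
  forall x : X, `|x| ^+ 2 = dot x x.

Definition span_set (n : nat) (e : 'I_n -> X) : set X :=
  range (fun c : 'I_n -> R => \sum_(i < n) c i *: e i).

Definition lin_indep (n : nat) (e : 'I_n -> X) : Prop :=
  forall c : 'I_n -> R, \sum_(i < n) c i *: e i = 0 -> forall i, c i = 0.

Definition fin_dim_subspace V : Prop :=
  exists (n : nat) (e : 'I_n -> X), V = span_set e.

Definition coercivity_const b : R :=
  inf [set b w w / `|w| ^+ 2 | w in [set w | w != 0]].

Definition continuity_const b : R :=
  sup [set sup [set `|b w v| / (`|w| * `|v|) | w in [set w | w != 0]]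
      | v in [set v | v != 0]].

(* The dual norm on V' of the restriction of r to V. *)
Definition dual_norm V r : R :=
  sup [set `|r v| / `|v| | v in [set v | V v /\ v != 0]].

End Spaces.

Section ParametrizedProblem.
Variables (R : realType) (X : normedModType R) (Np Q : nat).
Variables (Phi : 'I_Q -> 'I_2 -> 'I_2 -> 'rV[R]_Np -> R).
Variables (aq : 'I_Q -> 'I_2 -> 'I_2 -> {biscalar X}).
Variables (Phif : 'I_Q -> 'rV[R]_Np -> R) (fq : 'I_Q -> {scalar X}).

Definition form_a (p : 'rV[R]_Np) (u v : X) : R :=
  \sum_(q < Q) \sum_(i < 2) \sum_(j < 2) Phi q i j p * aq q i j u v.

Definition dform_a (kappa : midx Np) (p : 'rV[R]_Np) (u v : X) : R :=
  \sum_(q < Q) \sum_(i < 2) \sum_(j < 2)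
    midx_derive kappa (Phi q i j) p * aq q i j u v.

Definition dform_f (kappa : midx Np) (p : 'rV[R]_Np) (v : X) : R :=
  \sum_(q < Q) midx_derive kappa (Phif q) p * fq q v.

Definition uniformly_continuous_form (D : set 'rV[R]_Np) : Prop :=
  exists gamma : R, forall p, D p ->
    forall u v, `|form_a p u v| <= gamma * `|u| * `|v|.

Definition uniformly_coercive_form (D : set 'rV[R]_Np) : Prop :=
  exists2 alpha0 : R, 0 < alpha0 &
    forall p, D p -> forall w, alpha0 * `|w| ^+ 2 <= form_a p w w.

Variable p : 'rV[R]_Np.

Definition sensitivity_rhs (u : midx Np -> X) (nu : midx Np) (v : X) : R :=
  dform_f nu p v -
  \sum_(kappa \in midx_below nu (midx_order nu))
    (midx_binom nu kappa)%:R * dform_a kappa p (u (midx_sub nu kappa)) v.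

(* The recursion determines [u nu] for all |nu| <= nmax and leaves the other
   values of [u] unconstrained. *)
Definition galerkin_sensitivities (nmax : nat) (V : set X)
    (u : midx Np -> X) : Prop :=
  forall nu, (midx_order nu <= nmax)%N ->
    V (u nu) /\ forall v, V v -> form_a p (u nu) v = sensitivity_rhs u nu v.

Definition residual (u : midx Np -> X) (mu : midx Np) (v : X) : R :=
  sensitivity_rhs u mu v - form_a p (u mu) v.

(* The bound of order n; it is only used for |mu| = n.  For n = n'.+1 the order
   n - |kappa| is written n' - |kappa|.-1, which satisfies the guard condition;
   see [error_boundE] for the intended recursion. *)
Fixpoint error_bound_rec (Xh : set X) (ul : midx Np -> X) (n : nat)
    (mu : midx Np) {struct n} : R :=
  (coercivity_const (form_a p))^-1 *
  (dual_norm Xh (residual ul mu) +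
   (if n is n'.+1 then
      \sum_(kappa \in midx_below mu n'.+1)
        (midx_binom mu kappa)%:R * continuity_const (dform_a kappa p) *
        error_bound_rec Xh ul (n' - (midx_order kappa).-1) (midx_sub mu kappa)
    else 0)).

Definition error_bound (Xh : set X) (ul : midx Np -> X) (mu : midx Np) : R :=
  error_bound_rec Xh ul (midx_order mu) mu.

Lemma error_boundE (Xh : set X) (ul : midx Np -> X) (mu : midx Np) :
  error_bound Xh ul mu =
  (coercivity_const (form_a p))^-1 *
  (dual_norm Xh (residual ul mu) +
   \sum_(kappa \in midx_below mu (midx_order mu))
     (midx_binom mu kappa)%:R * continuity_const (dform_a kappa p) *
     error_bound Xh ul (midx_sub mu kappa)).
Proof.
rewrite {1}/error_bound; case En: (midx_order mu) => [|n] /=.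
  congr (_ * (_ + _)); rewrite (_ : midx_below _ _ = set0) ?fsbig_set0//.
  by apply/seteqP; split=> // k [_]; case: midx_order.
congr (_ * (_ + _)); apply: eq_fsbigr => k /set_mem [le_km /andP[k1 _]].
congr (_ * _); rewrite /error_bound midx_order_sub// En.
by case: (midx_order k) k1 => // m _; rewrite subSS.
Qed.

End ParametrizedProblem.

(* Main.v *)
Require Import Defs.
From HB Require Import structures.
From mathcomp Require Import all_boot all_order all_algebra.
From mathcomp Require Import all_classical all_reals all_analysis.
Set Implicit Arguments.
Unset Strict Implicit.
Unset Printing Implicit Defensive.
Import Order.TTheory GRing.Theory Num.Theory.
Import numFieldNormedType.Exports.
Local Open Scope classical_set_scope.
Local Open Scope ring_scope.

(** Let [e] be the error of the sensitivity of index [mu]. Subtracting the two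
    recursions and testing with [e], which lies in [Xh], gives
      [a(e, e) = r(e) - \sum_kappa binom(mu, kappa) d^kappa a(e_(mu - kappa), e)],
    where [e_(mu - kappa)] is an error of lower order. Coercivity bounds the
    left-hand side below by [alpha |e|^2]; the dual norm, the continuity
    constants and induction on [|mu|] bound the right-hand side by [|e|] times
    the bracket of the estimate. The suprema involved must be seen to be taken
    over bounded sets, since [sup] has the default value [0] otherwise. *)

(** * Domination by a multiple of a gauge *)

Section BoundedBy.
Variables (R : realType) (T : Type) (g : T -> R).
Implicit Types F G : T -> R.

(** The gauge [g] is the norm for linear forms and the product of the two norms for bilinear forms,
    so the closure properties below serve both. *)
Definition bounded_by F : Prop := exists C : R, forall t, `|F t| <= C * g t.

Lemma bounded_byB F G :
  bounded_by F -> bounded_by G -> bounded_by (fun t => F t - G t).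
Proof.
move=> [C FC] [C' GC']; exists (C + C') => t.
by rewrite (le_trans (ler_normB _ _))// mulrDl lerD.
Qed.

Lemma bounded_byZ (c : R) F : bounded_by F -> bounded_by (fun t => c * F t).
Proof.
by move=> [C FC]; exists (`|c| * C) => t; rewrite normrM -mulrA ler_wpM2l.
Qed.

Lemma bounded_by_sum (I : Type) (s : seq I) (F : I -> T -> R) :
  (forall i, bounded_by (F i)) -> bounded_by (fun t => \sum_(i <- s) F i t).
Proof.
move=> /choice[C FC]; exists (\sum_(i <- s) C i) => t.
by rewrite (le_trans (ler_norm_sum _ _ _))// mulr_suml ler_sum.
Qed.

Lemma bounded_by_fsbig (I : choiceType) (A : set I) (F : I -> T -> R) :
  finite_set A -> (forall i, bounded_by (F i)) ->
  bounded_by (fun t => \sum_(i \in A) F i t).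
Proof.
move=> finA /(bounded_by_sum (finmap.enum_fset (fset_set A)))[C FC]; exists C => t.
by rewrite fsbig_finite.
Qed.

End BoundedBy.

(** An empty or unbounded set causes no harm: its [sup] is the default value 0. *)
Lemma sup_ge0_of_nonneg (R : realType) (A : set R) :
  (forall x, A x -> 0 <= x) -> 0 <= sup A.
Proof.
move=> A_ge0; have [supA|/sup_out->//] := pselect (has_sup A).
have [[x Ax] _] := supA.
exact: le_trans (A_ge0 _ Ax) (ub_le_sup supA.2 Ax).
Qed.

(** Each entry of a multiindex is at most its order, so all these indices come from functions into
    ['I_n.+1]. *)
Lemma finite_midx_below (N : nat) (mu : midx N) (n : nat) :
  finite_set (midx_below mu n).
Proof.
pose g (k : {ffun 'I_N -> 'I_n.+1}) : midx N := [ffun i => val (k i)].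
apply: (@sub_finite_set _ _ (range g)); last first.
  by apply: finite_image; exact: finite_finset.
move=> k [_ /andP[_ kn]]; exists [ffun i => inord (k i)] => //.
apply/ffunP => i; rewrite !ffunE /= inordK// ltnS (leq_trans _ kn)//.
by rewrite /midx_order (bigD1 i)//= leq_addr.
Qed.

(** * Dual norm, continuity constant and coercivity constant *)

Section Constants.
Variables (R : realType) (X : normedModType R).
Implicit Types (b : X -> X -> R) (r : X -> R) (V : set X).

Lemma dual_norm_ge0 V r : 0 <= dual_norm V r.
Proof. by apply: sup_ge0_of_nonneg => _ [v _ <-]; rewrite divr_ge0. Qed.

Lemma continuity_const_ge0 b : 0 <= continuity_const b.
Proof.
apply: sup_ge0_of_nonneg => _ [v _ <-].
by apply: sup_ge0_of_nonneg => _ [w _ <-]; rewrite divr_ge0// mulr_ge0.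
Qed.

Lemma le_dual_norm V r v : bounded_by (fun v => `|v|) r -> V v ->
  `|r v| <= dual_norm V r * `|v|.
Proof.
move=> [C rC] Vv; have [v0|v0] := eqVneq v 0.
  (* The quotients exclude 0, but domination by the norm forces [r 0 = 0]. *)
  by have := rC v; rewrite v0 normr0 !mulr0.
rewrite -ler_pdivrMr ?normr_gt0//; apply: ub_le_sup; last by exists v.
by exists C => _ [w [_ w0] <-]; rewrite ler_pdivrMr ?normr_gt0.
Qed.

Lemma le_continuity_const b w v :
  bounded_by (fun z : X * X => `|z.1| * `|z.2|) (fun z => b z.1 z.2) ->
  `|b w v| <= continuity_const b * (`|w| * `|v|).
Proof.
move=> [C bC]; have {}bC x y : `|b x y| <= C * (`|x| * `|y|) := bC (x, y).
have [w0|w0] := eqVneq w 0.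
  by have := bC w v; rewrite w0 normr0 !(mul0r, mulr0).
have [v0|v0] := eqVneq v 0.
  by have := bC w v; rewrite v0 normr0 !(mul0r, mulr0).
have quotient_le x y : x != 0 -> y != 0 -> `|b x y| / (`|x| * `|y|) <= C.
  by move=> x0 y0; rewrite ler_pdivrMr ?bC// mulr_gt0 ?normr_gt0.
rewrite -ler_pdivrMr ?mulr_gt0 ?normr_gt0//.
pose S y := [set `|b x y| / (`|x| * `|y|) | x in [set x | x != 0]].
have S_ub y : y != 0 -> ubound (S y) C.
  by move=> y0 _ [x x0 <-]; exact: quotient_le.
apply: (@le_trans _ _ (sup (S v))).
  by apply: ub_le_sup; [exists C; exact: S_ub | exists w].
apply: ub_le_sup; last by exists v.
(* The bound [C] passes to the inner suprema because their sets are nonempty: [y] itself can be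
   taken as first argument. *)
exists C => _ [y y0 <-]; apply: ge_sup; last exact: S_ub.
by exists (`|b y y| / (`|y| * `|y|)), y.
Qed.

Lemma bounded_by_partial (b : X -> X -> R) w :
  bounded_by (fun z : X * X => `|z.1| * `|z.2|) (fun z => b z.1 z.2) ->
  bounded_by (fun v : X => `|v|) (b w).
Proof.
by move=> [C bC]; exists (C * `|w|) => v; rewrite -mulrA (bC (w, v)).
Qed.

Lemma coercivity_const_ge (c : R) b : (exists w : X, w != 0) ->
  (forall w, c * `|w| ^+ 2 <= b w w) -> c <= coercivity_const b.
Proof.
move=> [w0 w0_neq0] bc; apply: lb_le_inf; first by exists (b w0 w0 / `|w0| ^+ 2), w0.
by move=> _ [w w_neq0 <-]; rewrite ler_pdivlMr ?bc// exprn_gt0 ?normr_gt0.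
Qed.

(** The constant [c] bounds the quotients from below, which makes their infimum a genuine lower
    bound. *)
Lemma le_coercivity_const (c : R) b w :
  (forall w, c * `|w| ^+ 2 <= b w w) ->
  coercivity_const b * `|w| ^+ 2 <= b w w.
Proof.
move=> bc; have [w0|w0] := eqVneq w 0.
  by have := bc w; rewrite w0 normr0 expr0n !mulr0.
rewrite -ler_pdivlMr ?exprn_gt0 ?normr_gt0//.
apply: ge_inf; last by exists w.
by exists c => _ [y y0 <-]; rewrite ler_pdivlMr ?bc// exprn_gt0 ?normr_gt0.
Qed.

(* If [X] is trivial, the infimum ranges over the empty set and its value is the
   default [0], so that [c <= coercivity_const b] can fail. *)
Lemma coercivity_const_ge0 (c : R) b : 0 <= c ->
  (forall w, c * `|w| ^+ 2 <= b w w) -> 0 <= coercivity_const b.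
Proof.
move=> c_ge0 bc.
have [[w w0]|Xtriv] := pselect (exists w : X, w != 0).
  by rewrite (le_trans c_ge0)// (coercivity_const_ge _ bc)//; exists w.
rewrite /coercivity_const (_ : mkset _ = set0) ?image_set0 ?inf0//.
by apply/seteqP; split=> // w w0; apply: Xtriv; exists w.
Qed.

(** This puts the span of the reduced basis inside [Xh]. *)
Lemma fin_dim_subspace_lincomb V : fin_dim_subspace V ->
  forall (n : nat) (e : 'I_n -> X) (c : 'I_n -> R), (forall i, V (e i)) ->
  V (\sum_(i < n) c i *: e i).
Proof.
move=> [m [f ->]] n e c eV.
have /choice[d de] i : exists d : 'I_m -> R, \sum_(j < m) d j *: f j = e i.
  by have [d _ de] := eV i; exists d.
exists (fun j => \sum_(i < n) c i * d i j) => //.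
under eq_bigr do rewrite scaler_suml.
rewrite exchange_big; apply: eq_bigr => i _ /=.
rewrite -de scaler_sumr.
by apply: eq_bigr => j _; rewrite scalerA.
Qed.

Lemma fin_dim_subspaceB V x y : fin_dim_subspace V -> V x -> V y -> V (x - y).
Proof.
move=> [m [f ->]] [c _ <-] [d _ <-]; exists (fun j => c j - d j) => //.
by rewrite -sumrB; apply: eq_bigr => j _; rewrite scalerBl.
Qed.

End Constants.

(** * Linearity and boundedness of the affinely parametrized forms *)

Section Forms.
Variables (R : realType) (X : normedModType R) (Np Q : nat).
Variables (Phi : 'I_Q -> 'I_2 -> 'I_2 -> 'rV[R]_Np -> R).
Variables (aq : 'I_Q -> 'I_2 -> 'I_2 -> {biscalar X}).
Variables (Phif : 'I_Q -> 'rV[R]_Np -> R) (fq : 'I_Q -> {scalar X}).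
Variable p : 'rV[R]_Np.

(** With the coefficients left free, [form_a] and every [dform_a] are instances. *)
Definition affine_form (c : 'I_Q -> 'I_2 -> 'I_2 -> R) (w v : X) : R :=
  \sum_(q < Q) \sum_(i < 2) \sum_(j < 2) c q i j * aq q i j w v.

Lemma affine_formBl c w w' v :
  affine_form c (w - w') v = affine_form c w v - affine_form c w' v.
Proof.
rewrite -sumrB; apply: eq_bigr => q _; rewrite -sumrB; apply: eq_bigr => i _.
by rewrite -sumrB; apply: eq_bigr => j _; rewrite linearBl mulrBr.
Qed.

Lemma form_aBl w w' v :
  form_a Phi aq p (w - w') v = form_a Phi aq p w v - form_a Phi aq p w' v.
Proof. exact: affine_formBl (fun q i j => Phi q i j p) w w' v. Qed.

Lemma dform_aBl kappa w w' v : dform_a Phi aq kappa p (w - w') v =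
  dform_a Phi aq kappa p w v - dform_a Phi aq kappa p w' v.
Proof.
exact: affine_formBl (fun q i j => midx_derive kappa (Phi q i j) p) w w' v.
Qed.

(** The derivatives of [f] do not depend on the family and cancel. *)
Lemma sensitivity_rhsB (u u' : midx Np -> X) mu v :
  sensitivity_rhs Phi aq Phif fq p u mu v -
  sensitivity_rhs Phi aq Phif fq p u' mu v =
  - \sum_(kappa \in midx_below mu (midx_order mu))
      (midx_binom mu kappa)%:R *
      dform_a Phi aq kappa p
        (u (midx_sub mu kappa) - u' (midx_sub mu kappa)) v.
Proof.
rewrite /sensitivity_rhs !fsbig_finite//=; do ?exact: finite_midx_below.
rewrite opprB addrC addrA subrK -opprB -sumrB; congr (- _).
by apply: eq_bigr => k _; rewrite dform_aBl mulrBr.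
Qed.

Hypothesis aq_cont :
  forall q i j, continuous (fun z : X * X => aq q i j z.1 z.2).
Hypothesis fq_cont : forall q, continuous (fq q).

Lemma affine_form_bounded c : bounded_by (fun z : X * X => `|z.1| * `|z.2|)
  (fun z => affine_form c z.1 z.2).
Proof.
apply: bounded_by_sum => q; apply: bounded_by_sum => i.
apply: bounded_by_sum => j; apply: bounded_byZ.
have [C _ aC] := @bilinear_schwarz R X X R (aq q i j) (@aq_cont q i j).
by exists C => z; rewrite mulrA.
Qed.

Lemma form_a_bounded : bounded_by (fun z : X * X => `|z.1| * `|z.2|)
  (fun z => form_a Phi aq p z.1 z.2).
Proof. exact: affine_form_bounded (fun q i j => Phi q i j p). Qed.

Lemma dform_a_bounded kappa : bounded_by (fun z : X * X => `|z.1| * `|z.2|)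
  (fun z => dform_a Phi aq kappa p z.1 z.2).
Proof.
exact: affine_form_bounded (fun q i j => midx_derive kappa (Phi q i j) p).
Qed.

Lemma dform_f_bounded kappa :
  bounded_by (fun v : X => `|v|) (dform_f Phif fq kappa p).
Proof.
apply: bounded_by_sum => q; apply: bounded_byZ.
have /linear_boundedP/pinfty_ex_gt0[C _ fC] :=
  @continuous_linear_bounded R X R 0 (fq q) (@fq_cont q 0).
by exists C.
Qed.

Lemma residual_bounded u mu :
  bounded_by (fun v : X => `|v|) (residual Phi aq Phif fq p u mu).
Proof.
apply: bounded_byB; last exact: bounded_by_partial form_a_bounded.
apply: bounded_byB; first exact: dform_f_bounded.
apply: bounded_by_fsbig => [|k]; first exact: finite_midx_below.
apply: bounded_byZ.
exact/bounded_by_partial/dform_a_bounded.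
Qed.

End Forms.

Theorem theorem4p2 (R : realType) (X : completeNormedModType R)
    (dot : {dot X for (@idfun R)}) (dot_norm : norm_of_dot dot)
    (X_separable : separable X)
    (Np Q nmax : nat) (D : set 'rV[R]_Np) (D_open : open D)
    (Phi : 'I_Q -> 'I_2 -> 'I_2 -> 'rV[R]_Np -> R)
    (aq : 'I_Q -> 'I_2 -> 'I_2 -> {biscalar X})
    (Phif : 'I_Q -> 'rV[R]_Np -> R) (fq : 'I_Q -> {scalar X})
    (Phi_diff : forall q i j, n_differentiable nmax D (Phi q i j))
    (Phif_diff : forall q, n_differentiable nmax D (Phif q))
    (aq_cont : forall q i j, continuous (fun z : X * X => aq q i j z.1 z.2))
    (fq_cont : forall q, continuous (fq q))
    (a_cont : uniformly_continuous_form Phi aq D)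
    (a_coer : uniformly_coercive_form Phi aq D)
    (Xh : set X) (Xh_fin : fin_dim_subspace Xh)
    (l : nat) (psi : 'I_l -> X) (psi_free : lin_indep psi)
    (psi_Xh : forall i, Xh (psi i))
    (p : 'rV[R]_Np) (Dp : D p)
    (u : midx Np -> X)
    (u_fe : galerkin_sensitivities Phi aq Phif fq p nmax Xh u)
    (ul : midx Np -> X)
    (ul_red : galerkin_sensitivities Phi aq Phif fq p nmax (span_set psi) ul)
    (mu : midx Np) (mu_le : (midx_order mu <= nmax)%N) :
  `|u mu - ul mu| <= error_bound Phi aq Phif fq p Xh ul mu.

Proof.
have [n] := ubnP (midx_order mu); elim: n mu mu_le => // n IHn mu mu_le mu_lt.
have [alpha0 alpha0_gt0 a_alpha0] := a_coer; have {}a_alpha0 := a_alpha0 _ Dp.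
have [Xh_u u_eq] := u_fe _ mu_le.
have [span_ul _] := ul_red _ mu_le.
set e := u mu - ul mu; set alpha := coercivity_const (form_a Phi aq p).
have Xh_e : Xh e.
  apply: fin_dim_subspaceB => //; have [c _ <-] := span_ul.
  exact: fin_dim_subspace_lincomb.
have IH kappa : midx_below mu (midx_order mu) kappa ->
    `|u (midx_sub mu kappa) - ul (midx_sub mu kappa)| <=
    error_bound Phi aq Phif fq p Xh ul (midx_sub mu kappa).
  move=> [le_km /andP[k_gt0 k_le]].
  have lt_sub : (midx_order (midx_sub mu kappa) < midx_order mu)%N.
    by rewrite midx_order_sub// ltn_subrL k_gt0 (leq_trans k_gt0).
  apply: IHn; first by rewrite (leq_trans _ mu_le)// ltnW.
  by rewrite (leq_trans lt_sub).
rewrite error_boundE -/alpha fsbig_finite/=; last exact: finite_midx_below.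
set S := \sum_(_ <- _) _; set rho := dual_norm _ _.
(* The bounds of lower order are nonnegative since, by [IH], they dominate norms. *)
have S_ge0 : 0 <= S.
  rewrite /S big_seq sumr_ge0// => k.
  rewrite in_fset_set ?inE; last exact: finite_midx_below.
  move=> /IH /(le_trans (normr_ge0 _)) bound_ge0.
  by rewrite !mulr_ge0 ?continuity_const_ge0.
(* For [e = 0] a nonnegative right-hand side suffices. A nonzero [e] shows that [X] is nontrivial,
   whence [alpha > 0], and allows its norm to be cancelled. *)
have [e0|e_neq0] := eqVneq e 0.
  rewrite e0 normr0 mulr_ge0 ?addr_ge0 ?dual_norm_ge0// invr_ge0.
  exact: coercivity_const_ge0 (ltW alpha0_gt0) a_alpha0.
have alpha_gt0 : 0 < alpha.
  rewrite (lt_le_trans alpha0_gt0)// (coercivity_const_ge _ a_alpha0)//.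
  by exists e.
have ne_gt0 : 0 < `|e| by rewrite normr_gt0.
rewrite ler_pdivlMl// -(ler_pM2r ne_gt0) -mulrA -expr2.
apply: (le_trans (le_coercivity_const _ a_alpha0)).
(* Only the equation of [u] may be tested with [e]; that of [ul] holds on the reduced space alone,
   and its defect on [Xh] is the residual. *)
have -> : form_a Phi aq p e e = residual Phi aq Phif fq p ul mu e +
    (sensitivity_rhs Phi aq Phif fq p u mu e -
     sensitivity_rhs Phi aq Phif fq p ul mu e).
  by rewrite form_aBl u_eq// /residual [RHS]addrC addrA subrK.
rewrite mulrDl lerD//.
  exact/(le_trans (ler_norm _))/le_dual_norm/Xh_e/residual_bounded.
rewrite sensitivity_rhsB fsbig_finite/=; last exact: finite_midx_below.
rewrite (le_trans (ler_norm _))// normrN (le_trans (ler_norm_sum _ _ _))//.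
(* [big_seq] keeps the membership of [k] in the index set, which [IH] requires. *)
rewrite mulr_suml big_seq [leRHS]big_seq ler_sum// => k.
rewrite in_fset_set ?inE => [/IH IHk|]; last exact: finite_midx_below.
rewrite normrM ger0_norm// -!mulrA ler_wpM2l//.
apply: (le_trans (le_continuity_const _ _ (dform_a_bounded _ _ aq_cont _))).
by rewrite ler_wpM2l ?continuity_const_ge0// ler_wpM2r.
Qed.
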